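(* For all integers $n,r$ with $n\ge 2$ and $n>r\ge 1$, $$S(n,r)=\zeta(n),$$ where $S(n,r)$ is the sum of all multiple zeta values of weight $n$ and depth $r$, i.e. $$S(n,r)=\sum_{\substack{k_1+\dots+k_r=n\\ k_1\ge 2,\ k_2,\dots,k_r\ge 1}}\zeta(k_1,\dots,k_r).$$
   Context: For integers $k_1\ge 2$, $k_2,\dots,k_r\ge 1$, the multiple zeta value is $\zeta(k_1,\dots,k_r)=\sum_{n_1>n_2>\dots>n_r>0}\frac{1}{n_1^{k_1}n_2^{k_2}\cdots n_r^{k_r}}$. Its weight is $k_1+\dots+k_r$ and its depth is $r$. $\zeta(n)=\sum_{k\ge1}k^{-n}$. *)

(* Defs.v *)
From HB Require Import structures.
From mathcomp Require Import all_boot all_order all_algebra.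
From mathcomp Require Import all_classical all_reals all_analysis.
Set Implicit Arguments.
Unset Strict Implicit.
Unset Printing Implicit Defensive.
Import Order.TTheory GRing.Theory Num.Theory.
Import numFieldNormedType.Exports.
Local Open Scope classical_set_scope.
Local Open Scope ring_scope.

(* The value of the Riemann zeta function at an integer n >= 2. *)
Definition zeta (R : realType) (n : nat) : R :=
  \big[+%R/0]_(1 <= k <oo) (k%:R : R) ^- n.

(* The index set n_1 > n_2 > ... > n_r > 0. *)
Definition mzv_index (r : nat) : set (r.-tuple nat) :=
  [set m : r.-tuple nat | sorted gtn m && all (ltn 0%N) m].
Arguments mzv_index r : clear implicits.

(* The terms are nonnegative, so the unordered sum always makes sense in
   [0, +oo], and it is a real number exactly when the series converges. *)
Definition mzv (R : realType) (r : nat) (k : r.-tuple nat) : \bar R :=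
  \esum_(m in mzv_index r)
    (\prod_(i < r) ((tnth m i)%:R : R) ^- (tnth k i))%:E.

(* k_1 >= 2 and k_2, ..., k_r >= 1, for a nonempty k. *)
Definition admissible (k : seq nat) : bool :=
  (2 <= head 0 k)%N && all (leq 1) (behead k).

(* The entries of a tuple of sum n are at most n, so letting them range over
   'I_n.+1 loses nothing and makes the sum a finite one. *)
Definition mzv_sum (R : realType) (n r : nat) : \bar R :=
  (\sum_(k : r.-tuple 'I_n.+1 |
          admissible (map val k) && (sumn (map val k) == n))
     mzv R (map_tuple val k))%E.

(* Main.v *)
Require Import Defs.
From mathcomp Require Import all_boot all_order all_algebra.
From mathcomp Require Import all_classical all_reals all_analysis.
From mathcomp Require Import ring lra.
Set Implicit Arguments.
Unset Strict Implicit.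
Unset Printing Implicit Defensive.
Import Order.TTheory GRing.Theory Num.Theory.
Import numFieldNormedType.Exports.
Local Open Scope classical_set_scope.
Local Open Scope ring_scope.

(** For 0 < x < 1, multiply the weight n sum by x^n and add over n: geometric
    series turn the sums of depth r into
      sum_(m_1 > ... > m_r > 0) x/m_1 * prod_i x/(m_i - x),
    and the zeta values of argument > r into sum_n x/(n - x) * (x/n)^r.
    These two are equal by the connected sum method of Seki and Yamamoto. The
    symmetric connector
      C(m, n) = Gamma(m+1-x) Gamma(n+1-x) / (Gamma(1-x) Gamma(m+n+1-x))
    satisfies C(m, 0) = 1 and, by telescoping,
      sum_(n > N) x/(n - x) * C(m, n) = x/m * C(m, N),
    so writing x/m_1 as a sum over n and then summing over m_1, ..., m_r in turn
    trades each m_i for a factor x/n. All terms are nonnegative, so every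
    interchange of sums takes place in [0, +oo], and the coefficients of the two
    power series in x can be compared. *)

(** * Unordered sums in [0, +oo] *)

Lemma esumZl (R : realType) (T : choiceType) (S : set T) (f : T -> \bar R)
    (c : R) : 0 <= c -> (forall t, S t -> (0 <= f t)%E) ->
  \esum_(t in S) (c%:E * f t)%E = (c%:E * \esum_(t in S) f t)%E.
Proof.
move=> c0 f0; rewrite /esum -ereal_supZl //; last first.
  by apply/set0P; exists (\sum_(x \in set0) f x)%E, set0 => //; exact: fsets_set0.
congr ereal_sup; rewrite image_comp; apply: eq_imagel => A [finA AS] /=.
rewrite !fsbig_finite // big_seq_cond [in RHS]big_seq_cond ge0_sume_distrr // => t.
by rewrite andbT in_fset_set // inE => /AS/f0.
Qed.

Lemma esum_swap (R : realType) (T U : choiceType) (S : set T) (S' : set U)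
    (f : T -> U -> \bar R) :
  (forall t u, S t -> S' u -> (0 <= f t u)%E) ->
  \esum_(t in S) \esum_(u in S') f t u = \esum_(u in S') \esum_(t in S) f t u.
Proof.
move=> f0; rewrite !esum_esum //; last by move=> u t ? ?; exact: f0.
rewrite (reindex_esum (S' `*` S) _ (fun x => (x.2, x.1))) //; split=> //=.
- by move=> [i j] [/=].
- by move=> [i1 i2] [j1 j2] /= _ _ [] -> ->.
- by move=> [i1 i2] [Pi1 Qi2] /=; exists (i2, i1).
Qed.

(** Prepending is a bijection onto [S] from the pairs of a tail and an allowed head; [J] depends on
    the tail because the range of n_1 depends on n_2. *)
Lemma esum_tupleS (R : realType) (T : choiceType) (r : nat)
    (S : set (r.+1.-tuple T)) (I : set (r.-tuple T))
    (J : r.-tuple T -> set T) (f : r.+1.-tuple T -> \bar R) :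
  (forall h (t : r.-tuple T), S [tuple of h :: t] <-> I t /\ J t h) ->
  (forall t, S t -> (0 <= f t)%E) ->
  \esum_(t in S) f t = \esum_(t in I) \esum_(h in J t) f [tuple of h :: t].
Proof.
move=> SE f0; rewrite esum_esum; last by move=> t h It Jh; apply/f0/SE.
apply: (reindex_esum (I `*`` J) _ (fun p => [tuple of p.2 :: p.1])); split.
- by move=> [t h] [/= It Jh]; apply/SE.
- move=> [t h] [t' h'] _ _ /= /(congr1 val) /= [-> tt']; congr pair.
  exact: val_inj.
- move=> t; rewrite /= (tuple_eta t) => /SE[It Jt].
  by exists (behead_tuple t, thead t).
Qed.

Lemma esum_tuple0 (R : realType) (T : choiceType) (S : set (0.-tuple T))
    (f : 0.-tuple T -> \bar R) : S [tuple] -> (0 <= f [tuple])%E ->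
  \esum_(t in S) f t = f [tuple].
Proof.
move=> S0 f0; rewrite (_ : S = [set [tuple]]) ?esum_set1 //.
by apply/seteqP; split => t; rewrite (tuple0 t).
Qed.

Lemma esum_series (R : realType) (u : nat -> R) (l : R) :
  (forall i, 0 <= u i) -> series u @ \oo --> l ->
  \esum_(i in [set: nat]) (u i)%:E = l%:E.
Proof.
move=> u0 ul; rewrite -nneseries_esumT; last by move=> i; rewrite lee_fin.
apply/cvg_lim => //.
rewrite (_ : (fun n => _) = EFin \o series u).
  by apply: cvg_EFin => //; exact: nearW.
by apply/funext => n /=; rewrite sumEFin.
Qed.

Lemma esum_gtn (R : realType) (N : nat) (f : nat -> \bar R) :
  \esum_(n in [set n | (N < n)%N]) f n =
  \esum_(i in [set: nat]) f (N.+1 + i)%N.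
Proof.
apply: reindex_esum; split => [i _|i j _ _|n /= Nn].
- by rewrite /= leq_addr.
- exact: addnI.
- by exists (n - N.+1)%N => //; rewrite subnKC.
Qed.

Lemma esum_telescope (R : realType) (N : nat) (u v : nat -> R) :
  (forall n, (N <= n)%N -> 0 <= u n.+1) ->
  (forall n, (N <= n)%N -> u n.+1 = v n - v n.+1) ->
  v @ \oo --> 0 ->
  \esum_(n in [set n | (N < n)%N]) (u n)%:E = (v N)%:E.
Proof.
move=> u0 uv v0; rewrite esum_gtn.
apply: (@esum_series R (fun i => u (N.+1 + i)%N)) => [i|].
  by rewrite addSn u0 // leq_addr.
have -> : series (fun i => u (N.+1 + i)%N) = fun n => v N - v (n + N)%N.
  apply/funext => n; rewrite seriesEnat /=.
  rewrite (@eq_big_nat _ _ _ _ _ _ (fun i => - v (i.+1 + N)%N - (- v (i + N)%N))).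
    by rewrite telescope_sumr // add0n opprK addrC.
  by move=> i _; rewrite addSn uv ?leq_addr // opprK addrC addSn (addnC i).
rewrite -[X in _ --> X]subr0; apply: cvgB; first exact: cvg_cst.
by have := v0; rewrite -(cvg_shiftn N).
Qed.

Lemma esum_finType (R : realType) (T : finType) (P : pred T) (f : T -> \bar R) :
  (forall t, P t -> (0 <= f t)%E) ->
  \esum_(t in [set t | P t]) f t = (\sum_(t | P t) f t)%E.
Proof.
move=> f0; rewrite esum_mkcond.
have -> : [set: T] = [set` enum T].
  by apply/seteqP; split => t //= _; rewrite mem_enum.
rewrite esum_fset; [|exact: finite_finset|]; last first.
  by move=> t _; case: ifPn => //; rewrite inE => /f0.
rewrite -fsbig_seq ?enum_uniq // big_enum [RHS]big_mkcond.
by apply: eq_bigr => t _; rewrite mem_setE.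
Qed.

Lemma esum_geometric (R : realType) (N : nat) (z : R) : 0 <= z < 1 ->
  \esum_(n in [set n | (N < n)%N]) (z ^+ n)%:E = (z ^+ N.+1 / (1 - z))%:E.
Proof.
move=> /andP[z0 z1]; rewrite esum_gtn.
apply: (@esum_series R (fun i => z ^+ (N.+1 + i))) => [i|].
  exact: exprn_ge0.
have -> : (fun i => z ^+ (N.+1 + i)) = geometric (z ^+ N.+1) z.
  by apply/funext => i /=; rewrite exprD.
by apply: cvg_geometric_series; rewrite ger0_norm.
Qed.

(** * Generating functions with coefficients in [0, +oo] *)

Definition ogf (R : realType) (a : nat -> \bar R) (x : R) : \bar R :=
  \esum_(n in [set: nat]) ((x ^+ n)%:E * a n)%E.

Lemma ogf_ge0 (R : realType) (a : nat -> \bar R) (x : R) :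
  (forall n, (0 <= a n)%E) -> 0 <= x -> (0 <= ogf a x)%E.
Proof.
move=> a0 x0; apply: esum_ge0 => n _; rewrite mule_ge0 // lee_fin.
exact: exprn_ge0.
Qed.

Lemma ogf_recl (R : realType) (a : nat -> \bar R) (x : R) :
  (forall n, (0 <= a n)%E) -> 0 <= x ->
  ogf a x = (a 0%N + x%:E * ogf (a \o succn) x)%E.
Proof.
move=> a0 x0; have p0 n : (0 <= (x ^+ n)%:E * a n)%E.
  by rewrite mule_ge0 // lee_fin exprn_ge0.
rewrite /ogf (esumID [set 0%N]) // setTI esum_set1 // expr0 mul1e; congr (_ + _)%E.
rewrite (_ : _ `&` _ = [set n | (0 < n)%N]); last first.
  by apply/seteqP; split => -[|n] //= [_].
rewrite esum_gtn -esumZl //; last first.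
  by move=> n _; rewrite mule_ge0 // ?lee_fin ?exprn_ge0 //; exact: a0.
by apply: eq_esum => n _; rewrite add1n exprS EFinM muleA.
Qed.

Lemma ogf_tail_lty (R : realType) (a : nat -> \bar R) (x : R) :
  (forall n, (0 <= a n)%E) -> 0 < x ->
  (ogf a x < +oo)%E -> (ogf (a \o succn) x < +oo)%E.
Proof.
move=> a0 x0 afin.
have G0 : (0 <= ogf (a \o succn) x)%E.
  by rewrite ogf_ge0 ?(ltW x0) // => n; exact: a0.
have xG0 : (0 <= x%:E * ogf (a \o succn) x)%E by rewrite mule_ge0 // lee_fin ltW.
have xG : (x%:E * ogf (a \o succn) x < +oo)%E.
  by apply: le_lt_trans afin; rewrite (@ogf_recl _ a) ?(ltW x0) // leeDr.
rewrite -[ogf _ x]mul1e -(mulVf (lt0r_neq0 x0)) EFinM -muleA.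
by rewrite lte_mul_pinfty // lee_fin invr_ge0 ltW.
Qed.

(** Let x tend to 0 in a_0 <= ogf a x = b_0 + x * ogf b' x, where b' is the shifted sequence: ogf b'
    x stays bounded for x <= 1/2. *)
Lemma ogf_coef0_le (R : realType) (a b : nat -> \bar R) :
  (forall n, (0 <= a n)%E) -> (forall n, (0 <= b n)%E) ->
  (ogf b 2^-1 < +oo)%E -> (forall x, 0 < x < 1 -> ogf a x = ogf b x) ->
  (a 0%N <= b 0%N)%E.
Proof.
move=> a0 b0 bfin ab; set b' := b \o succn.
have b'0 n : (0 <= b' n)%E by exact: b0.
have h0 : (0 : R) <= 2^-1 by lra.
have Gfin : (ogf b' 2^-1 < +oo)%E.
  by apply: ogf_tail_lty => //; rewrite invr_gt0.
have GF : ogf b' 2^-1 \is a fin_num by rewrite ge0_fin_numE // ogf_ge0.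
pose K := fine (ogf b' 2^-1).
have K0 : 0 <= K by rewrite fine_ge0 // ogf_ge0.
apply/lee_addgt0Pr => e e0.
(* The first bound keeps [ogf b' x] below [K], the second makes x * K at most e; the added 1 guards
   against [K] = 0. *)
pose x := Num.min 2^-1 (e / (K + 1)).
have x0 : 0 < x by rewrite lt_min invr_gt0 ltr0n divr_gt0 // ltr_wpDl.
have xh : x <= 2^-1 by rewrite ge_min lexx.
have xK : x * K <= e.
  have : x <= e / (K + 1) by rewrite ge_min lexx orbT.
  rewrite ler_pdivlMr ?ltr_wpDl // mulrDr mulr1 => h.
  by apply: le_trans h; rewrite lerDl ltW.
have x1 : 0 < x < 1 by rewrite x0 (le_lt_trans xh) //; lra.
apply: (@le_trans _ _ (ogf a x)).
  rewrite ogf_recl ?(ltW x0) // leeDl // mule_ge0 ?lee_fin ?(ltW x0) //.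
  rewrite ogf_ge0 ?(ltW x0) // => n.
  exact: a0.
rewrite ab // ogf_recl ?(ltW x0) // leeD2l // -/b'.
apply: (@le_trans _ _ (x%:E * ogf b' 2^-1)%E).
  rewrite lee_pmul2l // ?lte_fin //; apply: le_esum => n _.
  by rewrite lee_wpmul2r // lee_fin lerXn2r // nnegrE // ltW.
by rewrite -(fineK GF) -EFinM lee_fin.
Qed.

(** Induction on the index: the constant terms agree by two inequalities and, being finite, cancel;
    dividing by x leaves the same hypotheses for the shifted sequences. *)
Lemma ogf_inj (R : realType) (a b : nat -> \bar R) :
  (forall n, (0 <= a n)%E) -> (forall n, (0 <= b n)%E) ->
  (ogf b 2^-1 < +oo)%E -> (forall x, 0 < x < 1 -> ogf a x = ogf b x) ->
  a =1 b.
Proof.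
move=> + + + + n; elim: n a b => [|n IH] a b a0 b0 bfin ab.
  apply/le_anti/andP; split; first exact: ogf_coef0_le.
  (* Finiteness for [a] at 1/2 is inherited from [b] through the equality. *)
  by apply: ogf_coef0_le => // [|x x01]; rewrite ab //; lra.
have ab0 : a 0%N = b 0%N.
  apply/le_anti/andP; split; first exact: ogf_coef0_le.
  by apply: ogf_coef0_le => // [|x x01]; rewrite ab //; lra.
have h0 : (0 : R) <= 2^-1 by lra.
have b'0 k : (0 <= (b \o succn) k)%E by exact: b0.
have a'0 k : (0 <= (a \o succn) k)%E by exact: a0.
have b0fin : b 0%N \is a fin_num.
  rewrite ge0_fin_numE //; apply: le_lt_trans bfin.
  by rewrite ogf_recl // leeDl // mule_ge0 // ogf_ge0.
apply: (IH (a \o succn) (b \o succn)) => //.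
  by apply: ogf_tail_lty => //; rewrite invr_gt0.
move=> x /[dup] x01 /andP[x0 _]; have := ab x x01.
rewrite (@ogf_recl _ a) ?(ltW x0) // (@ogf_recl _ b) ?(ltW x0) // ab0.
rewrite ![(b 0%N + _)%E]addeC.
move=> /(congr1 (fun z => (x^-1)%:E * (z - b 0%N))%E); rewrite /= !addeK //.
by rewrite !muleA -!EFinM mulVf ?gt_eqF // !mul1e.
Qed.

(** * The connector *)

(** The Gamma quotient C(m, n), written without Gamma. *)
Definition connector (R : realType) (x : R) (m n : nat) : R :=
  \prod_(1 <= j < n.+1) ((j%:R - x) / ((m + j)%:R - x)).

Lemma natB_gt0 (R : realType) (x : R) (n : nat) : x < 1 -> (0 < n)%N -> 0 < n%:R - x.
Proof. by move=> x1; rewrite -(ler_nat R) subr_gt0 => /(lt_le_trans x1). Qed.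

Lemma connectorS (R : realType) (x : R) (m n : nat) :
  connector x m n.+1 = connector x m n * ((n.+1%:R - x) / ((m + n.+1)%:R - x)).
Proof. by rewrite /connector big_nat_recr. Qed.

Lemma connector0 (R : realType) (x : R) (m : nat) : connector x m 0 = 1.
Proof. by rewrite /connector big_geq. Qed.

Lemma connector_ge0 (R : realType) (x : R) (m n : nat) :
  x < 1 -> 0 <= connector x m n.
Proof.
move=> x1; rewrite /connector big_nat; apply: prodr_ge0 => j /andP[j0 _].
by rewrite divr_ge0 // ltW // natB_gt0 // addn_gt0 j0 orbT.
Qed.

Lemma connector_recl (R : realType) (x : R) (m n : nat) : x < 1 ->
  connector x m.+1 n = connector x m n * ((m.+1%:R - x) / ((m.+1 + n)%:R - x)).
Proof.
move=> x1; elim: n => [|n IH].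
  by rewrite !connector0 addn0 divff ?mulr1 // gt_eqF // natB_gt0.
rewrite !connectorS IH (addSnnS m n) -!mulrA; congr (_ * _).
by rewrite [LHS]mulrCA [RHS]mulrCA; congr (_ * _); exact: mulrCA.
Qed.

(** The product form hides the symmetry, but [connectorS] and [connector_recl] are one recurrence
    with the arguments exchanged, and C(0, n) and C(n, 0) are both 1. *)
Lemma connectorC (R : realType) (x : R) (m n : nat) :
  x < 1 -> connector x m n = connector x n m.
Proof.
move=> x1; elim: m => [|m IH]; last by rewrite connector_recl // connectorS IH addnC.
rewrite connector0 /connector big_nat big1 // => j /andP[j0 _].
by rewrite divff // gt_eqF // natB_gt0.
Qed.

(** Each new factor is at most (n+1)/(n+2), since m >= 1 and x > 0, and these bounds telescope. The
    decay removes the boundary term at infinity in [esum_wt_connector]. *)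
Lemma connector_le (R : realType) (x : R) (m n : nat) : 0 < x < 1 -> (0 < m)%N ->
  connector x m n <= n.+1%:R^-1.
Proof.
move=> /andP[x0 x1] m0; elim: n => [|n IH]; first by rewrite connector0 invr1.
rewrite connectorS (@le_trans _ _ (n.+1%:R^-1 * (n.+1%:R / n.+2%:R))) //; last first.
  by rewrite mulKf.
have B : 0 < (m + n.+1)%:R - x by rewrite natB_gt0 // addnS.
rewrite ler_pM ?connector_ge0 ?divr_ge0 //; try by rewrite ltW // natB_gt0.
rewrite ler_pdivrMr // mulrAC ler_pdivlMr //.
have m1 : (1 : R) <= m%:R by rewrite ler1n.
have n0 : (0 : R) <= n%:R by rewrite ler0n.
rewrite natrD -!natr1; nra.
Qed.

(** For 0 < x < 1 <= m this is the geometric series of (x/m)^k over k >= 1, the contribution of one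
    exponent. *)
Definition wt (R : realType) (x : R) (m : nat) : R := x / (m%:R - x).

Lemma wt_ge0 (R : realType) (x : R) (m : nat) :
  0 < x < 1 -> (0 < m)%N -> 0 <= wt x m.
Proof. by move=> /andP[x0 x1] m0; rewrite divr_ge0 // ltW // natB_gt0. Qed.

Lemma esum_wt_connector (R : realType) (x : R) (m N : nat) :
  0 < x < 1 -> (0 < m)%N ->
  \esum_(n in [set n | (N < n)%N]) (wt x n * connector x m n)%:E =
  (x / m%:R * connector x m N)%:E.
Proof.
move=> /[dup] x01 /andP[x0 x1] m0.
apply: (@esum_telescope _ N (fun n => wt x n * connector x m n)
                         (fun n => x / m%:R * connector x m n)).
- by move=> n _; rewrite mulr_ge0 ?wt_ge0 ?connector_ge0.
(* Both sides equal x C(m, n) / (m+n+1-x). *)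
- move=> n _; rewrite connectorS /wt.
  have A := natB_gt0 (n := n.+1) x1 isT.
  have B : 0 < (m + n.+1)%:R - x by rewrite natB_gt0 // addnS.
  rewrite natrD in B *; field.
  apply/and3P; split; last by move: A; rewrite -nat1r => /lt0r_neq0.
    by move: B; rewrite -nat1r => /lt0r_neq0.
  by rewrite pnatr_eq0 -lt0n.
rewrite -(mulr0 (x / m%:R)); apply: cvgM; first exact: cvg_cst.
apply: (squeeze_cvgr _ (cvg_cst 0) cvg_harmonic).
by apply: nearW => n; rewrite connector_ge0 //= connector_le.
Qed.

(** * Connected sums over the index set *)

(** The default 0 of [head] turns the condition into positivity of [h] when the tail is empty. *)
Lemma mzv_index_cons (r h : nat) (t : r.-tuple nat) :
  mzv_index r.+1 [tuple of h :: t] <-> mzv_index r t /\ (head 0%N t < h)%N.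
Proof.
case: t => -[|a s] sP; rewrite /mzv_index /= ?andbT; first by split=> [|[]].
split=> [/andP[/andP[ah ->] /andP[_ ->]] //|[/andP[-> /andP[-> ->]] ah]].
by rewrite /gtn /= ah (leq_ltn_trans _ ah).
Qed.

Lemma mzv_index_gt0 (r : nat) (t : r.-tuple nat) :
  mzv_index r t -> forall m, m \in (t : seq nat) -> (0 < m)%N.
Proof. by move=> /andP[_ /allP]. Qed.

Lemma esum_mzv_indexS (R : realType) (w : nat -> R) (f : nat -> \bar R) (r : nat) :
  (forall m, (0 < m)%N -> 0 <= w m) -> (forall m, (0 < m)%N -> (0 <= f m)%E) ->
  \esum_(t in mzv_index r.+1) ((\prod_(m <- t) w m)%:E * f (head 0%N t))%E =
  \esum_(t in mzv_index r) ((\prod_(m <- t) w m)%:E *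
    \esum_(h in [set h | (head 0%N t < h)%N]) ((w h)%:E * f h))%E.
Proof.
move=> w0 f0.
have P0 k (t : k.-tuple nat) : mzv_index k t -> 0 <= \prod_(m <- t) w m.
  by move=> /mzv_index_gt0 t0; rewrite big_seq prodr_ge0 // => m /t0 /w0.
rewrite (@esum_tupleS _ _ _ _ (mzv_index r) (fun t => [set h | (head 0%N t < h)%N])).
- apply: eq_esum => t It; rewrite -esumZl ?P0 //; last first.
    move=> h /= th; have h0 : (0 < h)%N by case: (h) th.
    by rewrite mule_ge0 ?lee_fin ?w0 ?f0.
  by apply: eq_esum => h _; rewrite big_cons /= mulrC EFinM muleA.
- exact: mzv_index_cons.
- move=> t It; rewrite mule_ge0 ?lee_fin ?P0 // f0 //.
  by case: t It => -[|a s] sP // /mzv_index_gt0 -> //; rewrite inE eqxx.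
Qed.

(** Induction on r for all j. Summing wt(h) C(h, n) over the largest entry h > h', with h' the next
    one, gives x/n * C(h', n) by symmetry and telescoping, so one entry becomes one more power of
    x/n. *)
Lemma connected_sum (R : realType) (x : R) (r j : nat) : 0 < x < 1 ->
  \esum_(t in mzv_index r) ((\prod_(m <- t) wt x m)%:E *
    \esum_(n in [set n | (0 < n)%N])
      (wt x n * (x / n%:R) ^+ j * connector x (head 0%N t) n)%:E)%E =
  \esum_(n in [set n | (0 < n)%N]) (wt x n * (x / n%:R) ^+ (j + r))%:E.
Proof.
move=> /[dup] x01 /andP[x0 x1].
have c0 i n : (0 < n)%N -> 0 <= wt x n * (x / n%:R) ^+ i.
  by move=> n0; rewrite mulr_ge0 ?wt_ge0 // exprn_ge0 // divr_ge0 // ltW.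
elim: r j => [|r IH] j.
  rewrite esum_tuple0 //=; last first.
    rewrite big_nil mul1e; apply: esum_ge0 => n n0.
    by rewrite lee_fin mulr_ge0 ?c0 ?connector_ge0.
  rewrite big_nil mul1e addn0; apply: eq_esum => n n0.
  (* The empty tuple has head 0, and C(0, n) = 1. *)
  by rewrite connectorC // connector0 mulr1.
rewrite (esum_mzv_indexS (f := fun m => \esum_(n in [set n | (0 < n)%N])
  (wt x n * (x / n%:R) ^+ j * connector x m n)%:E)%E); first last.
- move=> m _; apply: esum_ge0 => n n0.
  by rewrite lee_fin mulr_ge0 ?c0 ?connector_ge0.
- by move=> m; exact: wt_ge0.
rewrite addnS -addSn -IH; apply: eq_esum => t _; congr (_ * _)%E.
(* The weight of [h] moves inside the sum over n, so that the two sums can be exchanged. *)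
under eq_esum => h th.
  have h0 : (0 < h)%N by case: (h) th.
  rewrite -esumZl ?wt_ge0 //; last first.
    by move=> n n0; rewrite lee_fin mulr_ge0 ?c0 ?connector_ge0.
  over.
rewrite esum_swap; last first.
  move=> h n th n0; have h0 : (0 < h)%N by case: (h) th.
  by rewrite -EFinM lee_fin mulr_ge0 ?wt_ge0 // mulr_ge0 ?c0 ?connector_ge0.
apply: eq_esum => n n0.
transitivity (\esum_(h in [set h | (head 0 t < h)%N])
   ((wt x n * (x / n%:R) ^+ j)%:E * (wt x h * connector x n h)%:E))%E.
  by apply: eq_esum => h _; rewrite -!EFinM (connectorC _ n) // mulrCA.
rewrite esumZl ?c0 //; last first.
  move=> h th; have h0 : (0 < h)%N by case: (h) th.
  by rewrite lee_fin mulr_ge0 ?wt_ge0 ?connector_ge0.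
by rewrite esum_wt_connector // -EFinM exprSr !mulrA (connectorC (head _ _)).
Qed.

Lemma esum_prod_wt (R : realType) (x : R) (r : nat) : 0 < x < 1 ->
  \esum_(t in mzv_index r.+1)
    ((\prod_(m <- t) wt x m)%:E * (x / (head 0%N t)%:R)%:E)%E =
  \esum_(n in [set n | (0 < n)%N]) (wt x n * (x / n%:R) ^+ r.+1)%:E.
Proof.
move=> /[dup] x01 /andP[x0 x1]; rewrite -(connected_sum r.+1 0 x01).
apply: eq_esum => t It; congr (_ * _)%E.
have h0 : (0 < head 0%N t)%N.
  by case: t It => -[|a s] sP // /mzv_index_gt0 -> //; rewrite inE eqxx.
(* Telescoping at N = 0, where C(m, 0) = 1, opens x/m_1 into the sum over n that [connected_sum]
   starts from. *)
have := esum_wt_connector 0 x01 h0; rewrite connector0 mulr1 => <-.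
by apply: eq_esum => n _; rewrite expr0 mulr1.
Qed.

(** * Summation over the exponents *)

(** Serves with N = 0 for an exponent >= 1, with N = 1 for the leading exponent >= 2, and with N = r
    for the zeta values. *)
Lemma wt_geometric (R : realType) (x : R) (m N : nat) :
  0 < x < 1 -> (0 < m)%N ->
  \esum_(n in [set n | (N < n)%N]) ((x / m%:R) ^+ n)%:E =
  (wt x m * (x / m%:R) ^+ N)%:E.
Proof.
move=> /andP[x0 x1] m0.
have m0' : 0 < m%:R :> R by rewrite ltr0n.
rewrite esum_geometric; last first.
  rewrite divr_ge0 ?ltW //= ltr_pdivrMr // mul1r (lt_le_trans x1) //.
  by rewrite ler1n.
congr EFin; rewrite exprSr [LHS]mulrAC -mulrA mulrC; congr (_ * _).
have A := natB_gt0 x1 m0.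
rewrite /wt; field; rewrite !lt0r_neq0 //=.
Qed.

Lemma tnth_lift0 (T : Type) (r : nat) (t : r.+1.-tuple T) (i : 'I_r) :
  tnth t (lift ord0 i) = tnth (behead_tuple t) i.
Proof. by rewrite [in LHS](tuple_eta t) tnthS. Qed.

(** For fixed [m] the exponents vary independently, so the sum factors into geometric series, peeled
    off one at a time. *)
Lemma esum_positive_exponents (R : realType) (x : R) (r : nat) (m : r.-tuple nat) :
  0 < x < 1 -> (forall i, (0 < tnth m i)%N) ->
  \esum_(k in [set k : r.-tuple nat | all (leq 1) k])
     (\prod_(i < r) (x / (tnth m i)%:R) ^+ tnth k i)%:E =
  (\prod_(i < r) wt x (tnth m i))%:E.
Proof.
move=> /[dup] x01 /andP[x0 x1].
have y0 (k : nat) : 0 <= x / k%:R by rewrite divr_ge0 // ltW.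
elim: r m => [|r IH] m m0.
  by rewrite esum_tuple0 ?big_ord0.
rewrite (@esum_tupleS _ _ _ _ [set k | all (leq 1) k] (fun=> [set h | (0 < h)%N])).
- have t0 i : (0 < tnth (behead_tuple m) i)%N by rewrite tnth_behead m0.
  rewrite big_ord_recl mulrC EFinM.
  under [X in (X%:E * _)%E]eq_bigr => i _ do rewrite tnth_lift0.
  rewrite -IH // muleC -esumZl ?wt_ge0 //; last first.
    by move=> k _; rewrite lee_fin prodr_ge0 // => i _; exact: exprn_ge0.
  apply: eq_esum => k _.
  transitivity (\esum_(h in [set h | (0 < h)%N])
      ((\prod_(i < r) (x / (tnth (behead_tuple m) i)%:R) ^+ tnth k i)%:E *
       ((x / (tnth m ord0)%:R) ^+ h)%:E))%E.
    apply: eq_esum => h _; rewrite -EFinM big_ord_recl mulrC tnth0.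
    by congr (_ * _)%:E; apply: eq_bigr => i _; rewrite tnthS tnth_lift0.
  rewrite esumZl; last 2 first.
  + by rewrite prodr_ge0 // => i _; exact: exprn_ge0.
  + by move=> h _; rewrite lee_fin exprn_ge0.
  by rewrite (wt_geometric 0) // expr0 mulr1 muleC.
- by move=> h t /=; split=> [/andP[]|[-> ->]].
- by move=> k _; rewrite lee_fin prodr_ge0 // => i _; exact: exprn_ge0.
Qed.

(** The leading exponent starts at 2, so its geometric series carries the extra factor x/m_1 that
    [esum_prod_wt] expands. *)
Lemma esum_admissible (R : realType) (x : R) (r : nat) (m : r.+1.-tuple nat) :
  0 < x < 1 -> (forall i, (0 < tnth m i)%N) ->
  \esum_(k in [set k : r.+1.-tuple nat | admissible k])
     (\prod_(i < r.+1) (x / (tnth m i)%:R) ^+ tnth k i)%:E =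
  ((\prod_(i < r.+1) wt x (tnth m i))%:E * (x / (tnth m ord0)%:R)%:E)%E.
Proof.
move=> /[dup] x01 /andP[x0 x1] m0.
have y0 (k : nat) : 0 <= x / k%:R by rewrite divr_ge0 // ltW.
rewrite (@esum_tupleS _ _ _ _ [set k | all (leq 1) k] (fun=> [set h | (1 < h)%N])).
- have t0 i : (0 < tnth (behead_tuple m) i)%N by rewrite tnth_behead m0.
  rewrite big_ord_recl mulrC EFinM.
  under [X in (X%:E * _ * _)%E]eq_bigr => i _ do rewrite tnth_lift0.
  rewrite -esum_positive_exponents // -muleA -EFinM muleC -esumZl; last 2 first.
  + by rewrite mulr_ge0 ?wt_ge0.
  + by move=> k _; rewrite lee_fin prodr_ge0 // => i _; exact: exprn_ge0.
  apply: eq_esum => k _.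
  transitivity (\esum_(h in [set h | (1 < h)%N])
      ((\prod_(i < r) (x / (tnth (behead_tuple m) i)%:R) ^+ tnth k i)%:E *
       ((x / (tnth m ord0)%:R) ^+ h)%:E))%E.
    apply: eq_esum => h _; rewrite -EFinM big_ord_recl mulrC tnth0.
    by congr (_ * _)%:E; apply: eq_bigr => i _; rewrite tnthS tnth_lift0.
  rewrite esumZl; last 2 first.
  + by rewrite prodr_ge0 // => i _; exact: exprn_ge0.
  + by move=> h _; rewrite lee_fin exprn_ge0.
  by rewrite (wt_geometric 1) // expr1 muleC.
- by move=> h t; rewrite /admissible /=; split=> [/andP[]|[-> ->]].
- by move=> k _; rewrite lee_fin prodr_ge0 // => i _; exact: exprn_ge0.
Qed.

(** * Generating function of the sums of multiple zeta values *)

Lemma mzv_ge0 (R : realType) (r : nat) (k : r.-tuple nat) : (0 <= mzv R k)%E.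
Proof.
by apply: esum_ge0 => m _; rewrite lee_fin prodr_ge0.
Qed.

(** Freed of the bound depending on n, the tuples of all weights lie in one type and can be summed
    together. *)
Lemma mzv_sumE (R : realType) (n r : nat) :
  mzv_sum R n r =
  \esum_(k in [set k : r.-tuple nat | admissible k && (sumn k == n)]) mzv R k.
Proof.
rewrite /mzv_sum -esum_finType; last by move=> k _; exact: mzv_ge0.
symmetry; apply: (reindex_esum _ _
  (fun k : r.-tuple 'I_n.+1 => map_tuple val k)); split => //=.
- move=> k k' _ _ /(congr1 val) /= kk'; apply: val_inj.
  exact: inj_map val_inj _ _ kk'.
- move=> k /andP[ak /eqP sk]; have kn : all (gtn n.+1) k.
    apply/allP => a ak'; rewrite /= ltnS -sk.
    by rewrite (perm_sumn (perm_to_rem ak')) /= leq_addr.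
  (* [inord] is undone by [val] here because no entry exceeds the sum n. *)
  exists (map_tuple inord k) => /=.
    by rewrite -map_comp map_id_in ?ak ?sk ?eqxx // => a /(allP kn); exact: inordK.
  apply: val_inj; rewrite /= -map_comp map_id_in // => a /(allP kn); exact: inordK.
Qed.

Lemma sumn_tnth (r : nat) (k : r.-tuple nat) : sumn k = (\sum_(i < r) tnth k i)%N.
Proof. by rewrite sumnE big_tuple. Qed.

Lemma ogf_mzv_sum (R : realType) (x : R) (r : nat) : 0 < x < 1 ->
  ogf (fun n => mzv_sum R n r.+1) x =
  \esum_(t in mzv_index r.+1)
    ((\prod_(m <- t) wt x m)%:E * (x / (head 0%N t)%:R)%:E)%E.
Proof.
move=> /[dup] x01 /andP[x0 x1].
pose K n := [set k : r.+1.-tuple nat | admissible k && (sumn k == n)].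
rewrite /ogf.
transitivity (\esum_(n in [set: nat]) \esum_(k in K n) ((x ^+ n)%:E * mzv R k)%E).
  apply: eq_esum => n _; rewrite mzv_sumE esumZl ?exprn_ge0 ?(ltW x0) // => k _.
  exact: mzv_ge0.
rewrite esum_esum; last first.
  by move=> n k _ _; rewrite mule_ge0 ?mzv_ge0 // lee_fin exprn_ge0 // ltW.
(* The weight is a function of [k], so the pairs (n, k) amount to the admissible [k]. *)
rewrite (reindex_esum [set k : r.+1.-tuple nat | admissible k] _
  (fun k => (sumn k, k))); last first.
  split=> [k ak|k k' _ _ []//|[n k] /= [_ /andP[ak /eqP <-]]]; last by exists k.
  by split=> //=; rewrite /K /= ak eqxx.
transitivity (\esum_(k in [set k : r.+1.-tuple nat | admissible k])
  \esum_(m in mzv_index r.+1)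
    (\prod_(i < r.+1) (x / (tnth m i)%:R) ^+ tnth k i)%:E).
  apply: eq_esum => k _ /=; rewrite /mzv -esumZl ?exprn_ge0 ?(ltW x0) //; last first.
    by move=> m _; rewrite lee_fin prodr_ge0 // => i _; rewrite invr_ge0 exprn_ge0.
  (* As n is the sum of the exponents, x^n spreads over the factors as x^(k_i). *)
  apply: eq_esum => m _; rewrite -EFinM sumn_tnth -prodrXr -big_split /=.
  by congr EFin; apply: eq_bigr => i _; rewrite exprMn exprVn.
rewrite esum_swap; last first.
  move=> k m _ _; rewrite lee_fin prodr_ge0 // => i _.
  by rewrite exprn_ge0 // divr_ge0 // ltW.
apply: eq_esum => m Im; rewrite esum_admissible //; last first.
  by move=> i; apply: mzv_index_gt0 Im _ _; exact: mem_tnth.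
by rewrite big_tuple; case: m Im => -[|a s] sP //= _; rewrite (tnth_nth 0%N).
Qed.

(** * Generating function of the zeta values *)

(** The exponents [0] and [1] are allowed; the value is then [+oo]. *)
Definition zeta_esum (R : realType) (n : nat) : \bar R :=
  \esum_(k in [set k | (0 < k)%N]) (k%:R ^- n)%:E.

Lemma zeta_esum_ge0 (R : realType) (n : nat) : (0 <= zeta_esum R n)%E.
Proof. by apply: esum_ge0 => k _; rewrite lee_fin invr_ge0 exprn_ge0. Qed.

Lemma zeta_esumE (R : realType) (n : nat) : (zeta_esum R n < +oo)%E ->
  zeta_esum R n = (zeta R n)%:E.
Proof.
rewrite /zeta_esum esum_gtn.
pose u i : R := (1 + i)%N%:R ^- n.
have u0 i : 0 <= u i by rewrite invr_ge0 exprn_ge0.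
rewrite -nneseries_esumT // => /nnseries_is_cvg ucvg.
have {}ucvg := ucvg u0; rewrite nneseries_esumT //; apply: esum_series => //.
suff -> : zeta R n = limn (series u) by [].
apply/cvg_lim => //; rewrite -(cvg_shiftn 1) /=.
rewrite [X in X @ _](_ : _ = series u) //; apply/funext => N.
by rewrite addn1 big_add1 seriesEnat; apply: eq_bigr => i _; rewrite /u add1n.
Qed.

(** The cut at r mirrors the depth: an admissible tuple of depth r >= 1 has weight at least r+1. For
    a fixed base k the sum over n > r is a geometric tail. *)
Lemma ogf_zeta (R : realType) (x : R) (r : nat) : 0 < x < 1 ->
  ogf (fun n => if (r < n)%N then zeta_esum R n else 0) x =
  \esum_(n in [set n | (0 < n)%N]) (wt x n * (x / n%:R) ^+ r)%:E.
Proof.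
move=> /[dup] x01 /andP[x0 x1].
transitivity (\esum_(n in [set n | (r < n)%N]) ((x ^+ n)%:E * zeta_esum R n)%E).
  rewrite /ogf [RHS]esum_mkcond; apply: eq_esum => n _.
  by case: ifPn => rn; [rewrite mem_set|rewrite memNset ?mule0 //; exact/negP].
transitivity (\esum_(n in [set n | (r < n)%N]) \esum_(k in [set k | (0 < k)%N])
   ((x / k%:R) ^+ n)%:E).
  apply: eq_esum => n _; rewrite /zeta_esum -esumZl ?exprn_ge0 ?(ltW x0) //.
  by apply: eq_esum => k _; rewrite exprMn exprVn.
rewrite esum_swap; last first.
  by move=> n k _ _; rewrite lee_fin exprn_ge0 // divr_ge0 // ltW.
by apply: eq_esum => k k0; rewrite wt_geometric.
Qed.

(** Comparison with a telescoping series: at x = 1/2, (x/n)^(r+1) <= 1/(2n) <= 2/(2n+1) = 2 C(1,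
    n). *)
Lemma esum_wt_lty (R : realType) (r : nat) :
  (\esum_(n in [set n | (0 < n)%N])
     (wt 2^-1 n * (2^-1 / n%:R) ^+ r.+1 : R)%:E < +oo)%E.
Proof.
have x01 : 0 < (2^-1 : R) < 1 by lra.
apply: (@le_lt_trans _ _ (\esum_(n in [set n | (0 < n)%N])
    (2%:E * (wt 2^-1 n * connector 2^-1 1 n : R)%:E))%E); last first.
  rewrite esumZl //; last first.
    by move=> n n0; rewrite lee_fin mulr_ge0 ?wt_ge0 ?connector_ge0 //; lra.
  by rewrite esum_wt_connector // -EFinM ltry.
apply: le_esum => n n0; rewrite -EFinM lee_fin mulrCA.
apply: ler_wpM2l; first exact: wt_ge0.
have n1 : (1 : R) <= n%:R by rewrite ler1n.
apply: (@le_trans _ _ (2^-1 / n%:R)).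
  rewrite exprS ler_piMr ?divr_ge0 // exprn_ile1 ?divr_ge0 //.
  by rewrite ler_pdivrMr; lra.
(* With the arguments exchanged the connector is a single factor. *)
rewrite connectorC; last by lra.
rewrite /connector big_nat1 ler_pdivrMr; last by lra.
have -> : 1%:R - 2^-1 = 2^-1 :> R by lra.
by rewrite mulVKf ?pnatr_eq0 // mulrC natrD ler_pdivlMr; lra.
Qed.

(** * Comparison of coefficients *)

(* The right-hand side is a real number, so the equality in \bar R also asserts
   that every multiple zeta value occurring in the sum is finite. *)
Theorem mainTheorem1 (R : realType) (n r : nat)
  (hn : (2 <= n)%N) (hr : (1 <= r)%N) (hrn : (r < n)%N) :
  mzv_sum R n r = (zeta R n)%:E.
Proof.
case: r hr hrn => // r _ hrn.
pose b m := if (r.+1 < m)%N then zeta_esum R m else 0%E.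
have b0 m : (0 <= b m)%E by rewrite /b; case: ifP => // _; exact: zeta_esum_ge0.
have bfin : (ogf b 2^-1 < +oo)%E.
  by rewrite ogf_zeta ?esum_wt_lty //; lra.
have E : (fun m => mzv_sum R m r.+1) =1 b.
  apply: ogf_inj => // [m|x x01].
    by apply: sume_ge0 => k _; exact: mzv_ge0.
  by rewrite ogf_mzv_sum // esum_prod_wt // ogf_zeta.
rewrite E /b hrn zeta_esumE //.
(* One term is at most the whole sum, so finiteness at 1/2 passes to the coefficient and yields the
   convergence of the zeta series. *)
have : ((2^-1 ^+ n)%:E * b n < +oo)%E.
  apply: le_lt_trans bfin; rewrite /ogf (esumID [set n]); last first.
    by move=> m _; rewrite mule_ge0 // lee_fin exprn_ge0.
  rewrite setTI esum_set1 ?leeDl //.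
    by apply: esum_ge0 => m _; rewrite mule_ge0 // lee_fin exprn_ge0.
  by rewrite mule_ge0 // lee_fin exprn_ge0.
rewrite /b hrn => h; have p0 : 0 < 2^-1 ^+ n :> R by rewrite exprn_gt0.
rewrite -[zeta_esum R n]mul1e -(mulVf (lt0r_neq0 p0)) EFinM -muleA.
by rewrite lte_mul_pinfty // lee_fin invr_ge0 ltW.
Qed.
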